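(* $R$ is a direct summand of $A$, i.e. there is an $R$-module map $f:A\to R$ with $f(r)=r$ for all $r\in R$.
   Context: Let $\Bbbk$ be a field of characteristic $p>0$ containing two elements $\alpha,\beta$ such that $\alpha\notin\mathbb F_p$ and $\beta\notin\mathbb F_p(\alpha)$. Let $S=\Bbbk[x_1,x_2,x_3,y]$, standard graded. Let $\tau_1,\tau_2,\tau_3,\sigma$ be the $\Bbbk$-algebra automorphisms of $S$ that fix $x_1$ and $x_3$ and satisfy $\tau_1: x_2\mapsto x_2+x_1,\ y\mapsto y+x_1$; $\tau_2: x_2\mapsto x_2+\alpha x_1,\ y\mapsto y+x_1$; $\tau_3: x_2\mapsto x_2,\ y\mapsto y+\beta x_1$; $\sigma: x_2\mapsto x_2,\ y\mapsto y+x_3$. Let $G=\langle\tau_1,\tau_2,\tau_3,\sigma\rangle$ and $G'=\langle\tau_1,\tau_2,\tau_3\rangle$, and write $R=S^G$, $A=S^{G'}$. *)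

(* Defs.v *)
From Stdlib Require List.
From HB Require Import structures.
From mathcomp Require Import all_boot all_algebra.
From mathcomp Require Import boolp.
From mathcomp Require Import mpoly.
Set Implicit Arguments.
Unset Strict Implicit.
Unset Printing Implicit Defensive.
Import GRing.Theory.
Local Open Scope ring_scope.

Section Subfields.
Variable (k : fieldType) (p : nat).

(* The prime subfield F_p of k; meaningful when p \in [pchar k]. *)
Definition prime_subfield : {pred k} := [pred x | [exists i : 'I_p, x == i%:R]].

(* F_p(a) is the intersection of all the subfields of k that contain F_p and
   a; over a field, [GRing.divring_closed] says exactly "is a subfield". *)
Definition in_prime_adjoin (a x : k) : Prop :=
  forall K : {pred k}, GRing.divring_closed K ->
    {subset prime_subfield <= K} -> a \in K -> x \in K.

End Subfields.

Section Invariants.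
Variables (k : fieldType) (S : comAlgType k).

(* When the elements of gens are bijective, this is the subgroup they generate
   in the group of k-algebra automorphisms of S, read up to pointwise equality
   of maps. *)
Inductive generated (gens : seq {lrmorphism S -> S}) :
    {lrmorphism S -> S} -> Prop :=
| generated_gen g : List.In g gens -> generated gens g
| generated_id : generated gens idfun
| generated_comp g h :
    generated gens g -> generated gens h -> generated gens (g \o h)
| generated_inv g (h : {lrmorphism S -> S}) :
    generated gens g -> cancel g h -> cancel h g -> generated gens h.

Lemma generated_bij (gens : seq {lrmorphism S -> S}) :
  (forall g : {lrmorphism S -> S}, List.In g gens -> bijective g) ->
  forall g : {lrmorphism S -> S}, generated gens g -> bijective g.
Proof.
move=> gensP g; elim=> {g} [g /gensP||g h _ bg _ bh|g h _ bg gh hg] //.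
- by exists idfun.
- exact: bij_comp.
- by exists g.
Qed.

Lemma generated_sub (gens1 gens2 : seq {lrmorphism S -> S}) :
  (forall g : {lrmorphism S -> S}, List.In g gens1 -> List.In g gens2) ->
  forall g, generated gens1 g -> generated gens2 g.
Proof.
move=> sub12 g; elim=> {g} [g /sub12||g h _ Gg _ Gh|g h _ Gg gh hg].
- exact: generated_gen.
- exact: generated_id.
- exact: generated_comp.
- exact: generated_inv Gg gh hg.
Qed.

Definition invariant (G : {lrmorphism S -> S} -> Prop) : {pred S} :=
  fun s => `[< forall g, G g -> g s = s >].

Lemma invariantP (G : {lrmorphism S -> S} -> Prop) s :
  reflect (forall g, G g -> g s = s) (s \in invariant G).
Proof. exact: asboolP. Qed.

Fact invariant_subring G : subring_closed (invariant G).
Proof.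
split=> [|s t /invariantP sG /invariantP tG|s t /invariantP sG /invariantP tG];
  apply/invariantP=> g Gg; first exact: rmorph1.
- by rewrite raddfB /= (sG _ Gg) (tG _ Gg).
- by rewrite rmorphM /= (sG _ Gg) (tG _ Gg).
Qed.

HB.instance Definition _ G :=
  GRing.isSubringClosed.Build S (invariant G) (invariant_subring G).

(* The invariant ring S^G. *)
Record invring (G : {lrmorphism S -> S} -> Prop) :=
  InvRing { invring_val : S; _ : invring_val \in invariant G }.

HB.instance Definition _ G := [isSub for @invring_val G].
HB.instance Definition _ G := [Choice of invring G by <:].
HB.instance Definition _ G := [SubChoice_isSubComNzRing of invring G by <:].

Section Inclusion.
Variables (G H : {lrmorphism S -> S} -> Prop) (sHG : forall g, H g -> G g).

Fact invariantS (s : S) : s \in invariant G -> s \in invariant H.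
Proof. by move=> /invariantP sG; apply/invariantP=> g /sHG; apply: sG. Qed.

(* The inclusion of S^G in S^H, for H a subgroup of G. *)
Definition invincl (r : invring G) : invring H := InvRing (invariantS (valP r)).

Fact invincl_zmod : zmod_morphism invincl.
Proof. by move=> r s; apply: val_inj. Qed.

Fact invincl_monoid : monoid_morphism invincl.
Proof. by split=> [|r s]; apply: val_inj. Qed.

HB.instance Definition _ :=
  GRing.isZmodMorphism.Build (invring G) (invring H) invincl invincl_zmod.
HB.instance Definition _ :=
  GRing.isMonoidMorphism.Build (invring G) (invring H) invincl invincl_monoid.

End Inclusion.
End Invariants.

(* R is a direct summand of A, as modules over R, where A is an R-algebra
   through the (inclusion) morphism i. *)
Definition direct_summand (R A : comNzRingType) (i : {rmorphism R -> A}) :=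
  exists f : {additive A -> R},
    (forall r a, f (i r * a) = r * f a) /\ (forall r, f (i r) = r).

Section Example.
Variable k : fieldType.
Notation S := {mpoly k[4]}.

Definition x1 : S := 'X_(@Ordinal 4 0 isT).
Definition x2 : S := 'X_(@Ordinal 4 1 isT).
Definition x3 : S := 'X_(@Ordinal 4 2 isT).
Definition y  : S := 'X_(@Ordinal 4 3 isT).

(* The k-algebra endomorphism of S sending x1, x2, x3, y to f1, f2, f3, f4. *)
Definition subst (f1 f2 f3 f4 : S) : {lrmorphism S -> S} :=
  comp_mpoly [tuple f1; f2; f3; f4].

Definition tau1 := subst x1 (x2 + x1) x3 (y + x1).
Definition tau2 (alpha : k) := subst x1 (x2 + alpha *: x1) x3 (y + x1).
Definition tau3 (beta : k) := subst x1 x2 x3 (y + beta *: x1).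
Definition sigma := subst x1 x2 x3 (y + x3).

Definition gensG (alpha beta : k) := [:: tau1; tau2 alpha; tau3 beta; sigma].
Definition gensG' (alpha beta : k) := [:: tau1; tau2 alpha; tau3 beta].

Definition G alpha beta := generated (gensG alpha beta).
Definition G' alpha beta := generated (gensG' alpha beta).

Lemma G'_sub_G alpha beta g : G' alpha beta g -> G alpha beta g.
Proof. by apply: generated_sub => h /= [|[|[|[]]]]; tauto. Qed.

Lemma substE f1 f2 f3 f4 :
  [/\ subst f1 f2 f3 f4 x1 = f1, subst f1 f2 f3 f4 x2 = f2,
      subst f1 f2 f3 f4 x3 = f3 & subst f1 f2 f3 f4 y = f4].
Proof. by split; rewrite /= comp_mpolyXU. Qed.

Lemma mpoly4_ext (g : {lrmorphism S -> S}) :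
  g x1 = x1 -> g x2 = x2 -> g x3 = x3 -> g y = y -> g =1 id.
Proof.
move=> g1 g2 g3 g4 q.
have gX i : g 'X_i = 'X_i.
  case: i => [[|[|[|[|//]]]] lti];
    [move: g1 | move: g2 | move: g3 | move: g4];
    by rewrite /x1 /x2 /x3 /y (bool_irrelevance isT lti).
rewrite {1}(mpolyE q) linear_sum /= [RHS]mpolyE; apply: eq_bigr => m _.
rewrite linearZ /= mpolyXE_id rmorph_prod /=; congr (_ *: _).
by apply: eq_bigr => i _; rewrite rmorphXn /= gX.
Qed.

Lemma shear_bij (a b c : k) :
  bijective (subst x1 (x2 + a *: x1) x3 (y + b *: x1 + c *: x3)).
Proof.
have shearK d e f : cancel (subst x1 (x2 + d *: x1) x3 (y + e *: x1 + f *: x3))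
    (subst x1 (x2 + (- d) *: x1) x3 (y + (- e) *: x1 + (- f) *: x3)).
  set g := subst _ _ _ _; set h := subst _ _ _ _.
  have [g1 g2 g3 g4] : [/\ g x1 = x1, g x2 = x2 + d *: x1, g x3 = x3
      & g y = y + e *: x1 + f *: x3] by exact: substE.
  have [h1 h2 h3 h4] : [/\ h x1 = x1, h x2 = x2 + (- d) *: x1, h x3 = x3
      & h y = y + (- e) *: x1 + (- f) *: x3] by exact: substE.
  apply: (@mpoly4_ext (h \o g)) => /=.
  - by rewrite g1.
  - by rewrite g2 linearD linearZ /= h1 h2 scaleNr subrK.
  - by rewrite g3.
  - by rewrite g4 !linearD !linearZ /= h1 h3 h4 !scaleNr addrAC subrK subrK.
exists (subst x1 (x2 + (- a) *: x1) x3 (y + (- b) *: x1 + (- c) *: x3)) => //.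
by have := shearK (- a) (- b) (- c); rewrite !opprK.
Qed.

Lemma gensG_bij alpha beta g : List.In g (gensG alpha beta) -> bijective g.
Proof.
case=> [|[|[|[|[]]]]] <-.
- by have := shear_bij 1 1 0; rewrite !scale1r scale0r addr0.
- by have := shear_bij alpha 1 0; rewrite scale1r scale0r addr0.
- by have := shear_bij 0 beta 0; rewrite !scale0r !addr0.
- by have := shear_bij 0 0 1; rewrite !scale0r scale1r !addr0.
Qed.

End Example.

(* Main.v *)
(** The automorphism [sigma] shifts [y] by [x3], while the powers of [tau3]
    shift it by [j * beta * x1] for [j] in [F_p]. Hence, for a [G']-invariant
    [a], the polynomial [a(y + T) - a] in [S[T]] vanishes at the [p] points
    [j * beta * x1], so it is divisible by [T^p - (beta * x1)^(p-1) * T], and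
    [T := x3] shows that [theta := x3^p - (beta * x1)^(p-1) * x3] divides
    [sigma a - a]. Thus [D := (sigma - 1) / theta] is an [R]-linear map
    [A -> A], and [D^p = 0] since [(sigma - 1)^p = sigma^p - 1 = 0].
    As [alpha^p <> alpha], there is an [f] in [A] of the form
    [y^p + u x2^p + (v x2 - w y) x1^(p-1)], additive in [(x2, y)], with
    [w = beta^(p-1)], so that [sigma f = f + theta]. If [b] is the falling
    factorial [f (f - theta) ... (f - (p-2) theta)], then
    [D^(p-1) b = (p-1)! = -1], and [a |-> - D^(p-1) (b a)] retracts [A] onto
    [R]. *)
Require Import Defs.
From Stdlib Require List.
From HB Require Import structures.
From mathcomp Require Import all_boot all_algebra.
From mathcomp Require Import boolp.
From mathcomp Require Import mpoly.
From mathcomp Require Import ring.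
Set Implicit Arguments.
Unset Strict Implicit.
Unset Printing Implicit Defensive.
Import GRing.Theory.
Local Open Scope ring_scope.

(** Newton's forward difference formula: expand the [n]-th power of [1 + (s - 1)], whose two
    summands commute. *)
Lemma iter_newton (V : zmodType) (s : {additive V -> V}) n v :
  iter n s v = \sum_(m < n.+1) iter m (fun x => s x - x) v *+ 'C(n, m).
Proof.
pose E m := iter m (fun x => s x - x) v.
have EC k : \sum_(m < k.+2) E m *+ 'C(k.+1, m) =
    \sum_(m < k.+1) E m *+ 'C(k, m) + \sum_(m < k.+1) E m.+1 *+ 'C(k, m).
  (* Pascal's rule; the extra top term carries ['C(k, k.+1) = 0]. *)
  transitivity (\sum_(m < k.+2) E m *+ 'C(k, m)
      + \sum_(m < k.+1) E m.+1 *+ 'C(k, m)); last first.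
    by rewrite big_ord_recr /= bin_small // mulr0n addr0.
  rewrite !(big_ord_recl k.+1) !bin0 -addrA -big_split /=; congr (_ + _).
  by apply: eq_bigr => m _; rewrite /bump leq0n add1n binS mulrnDr.
elim: n => [|n IHn]; first by rewrite big_ord1.
rewrite EC iterS IHn raddf_sum -big_split; apply: eq_bigr => m _ /=.
by rewrite raddfMn -mulrnDl addrC subrK.
Qed.

(** * A splitting criterion by divided differences *)

Section Splitting.
Variables (R A : comNzRingType) (i : {rmorphism R -> A}).
Variables (s : {rmorphism A -> A}) (p : nat) (t f : A).
Hypothesis charA : p \in [pchar A].
Hypothesis i_inj : injective i.
Hypothesis i_image : forall a, s a = a <-> exists r, i r = a.
Hypothesis t_lreg : GRing.lreg t.
Hypothesis s_t : s t = t.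
Hypothesis s_f : s f = f + t.
Hypothesis s_order : forall a, iter p s a = a.
Hypothesis s_mod : forall a, exists d, s a - a = t * d.

(** In Newton's formula for [s^p = 1], the prime [p] divides every inner binomial coefficient, so
    only the terms [m = 0] and [m = p] survive. *)
Lemma iter_sub_char a : iter p (fun x => s x - x) a = 0.
Proof.
have p_pr := pcharf_prime charA; have p_gt0 := prime_gt0 p_pr.
have := iter_newton s p a; rewrite s_order big_ord_recr /= binn mulr1n.
have -> : \sum_(m < p) iter m (fun x => s x - x) a *+ 'C(p, m) = a.
  case: (p) p_gt0 charA => // n _ ch; rewrite big_ord_recl /= bin0 mulr1n.
  rewrite big1 ?addr0 // => j _.
  by rewrite -mulr_natr (bin_lt_pcharf_0 ch) ?mulr0 //= /bump leq0n add1n ltnS.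
by rewrite addrC => /eqP; rewrite -subr_eq subrr => /eqP.
Qed.

Fixpoint ffact n := if n is m.+1 then ffact m * (f - t *+ m) else 1.

(** [s] sends each factor [f - m t] to the preceding one, so the product telescopes: [f + t] enters
    and the last factor leaves. *)
Lemma s_ffactS n : s (ffact n.+1) = (f + t) * ffact n.
Proof.
elim: n => [|n IHn]; first by rewrite /= mulr0n subr0 mul1r mulr1.
rewrite [in LHS]/= rmorphM IHn rmorphB raddfMn /= s_f s_t -mulrA.
by congr (_ * (_ * _)); rewrite mulrS opprD addrA addrK.
Qed.

Lemma s_sub_ffactS n : s (ffact n.+1) - ffact n.+1 = t * (ffact n *+ n.+1).
Proof.
rewrite s_ffactS /= [ffact n * _]mulrC -mulrBl opprB.
by rewrite addrC addrA subrK -mulrSr mulrnAl mulrnAr.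
Qed.

Lemma direct_summand_invariants : direct_summand i.
Proof.
have p_pr := pcharf_prime charA; have p_gt1 := prime_gt1 p_pr.
have [D DE] := choice s_mod.
have tDE n a : t ^+ n * iter n D a = iter n (fun x => s x - x) a.
  elim: n a => [|n IHn] a; first by rewrite mul1r.
  by rewrite /= -IHn exprSr -mulrA -DE mulrBr rmorphM rmorphXn s_t.
(* [D] comes from a choice of quotients; regularity of [t] makes these unique, hence [D] linear. The
   shape [c * a - b] covers additivity ([c = 1]) and scaling ([b = 0]) at once. *)
have D_lin c a b : s c = c -> D (c * a - b) = c * D a - D b.
  move=> sc; apply: t_lreg; rewrite mulrBr mulrCA -!DE.
  by rewrite rmorphB rmorphM sc mulrBr !opprD !opprK addrACA.
have iterD_lin n c a b : s c = c ->
    iter n D (c * a - b) = c * iter n D a - iter n D b.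
  by move=> sc; elim: n => //= n ->; rewrite D_lin.
(* The defect is [t * D^p a], and [t^p * D^p = (s - 1)^p = 0] with [t] regular. *)
have sD a : s (iter p.-1 D a) = iter p.-1 D a.
  apply/eqP; rewrite -subr_eq0 DE -iterS prednK ?prime_gt0 //.
  suff -> : iter p D a = 0 by rewrite mulr0.
  by apply: (lregX (n := p) t_lreg); rewrite mulr0 tDE iter_sub_char.
have iterD0 n : iter n D 0 = 0.
  have := iterD_lin n 1 0 0 (rmorph1 s).
  by rewrite mulr0 subr0 mul1r subrr.
have D_ffact n : iter n D (ffact n) = n`!%:R.
  elim: n => //= n IHn; rewrite -iterS iterSr.
  have -> : D (ffact n.+1) = n.+1%:R * ffact n - 0.
    by apply: t_lreg; rewrite -DE s_sub_ffactS subr0 mulr_natl.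
  by rewrite iterD_lin ?rmorph_nat // iterD0 IHn subr0 factS natrM.
pose phi a := - iter p.-1 D (ffact p.-1 * a).
have phi_lin c a b : s c = c -> phi (c * a - b) = c * phi a - phi b.
  by move=> sc; rewrite /phi mulrBr mulrCA iterD_lin // mulrN opprB opprK addrC.
have sphi a : s (phi a) = phi a by rewrite rmorphN sD.
have [g gE] : exists g : A -> R, forall a, i (g a) = phi a.
  by have [g] := choice (fun a => (i_image (phi a)).1 (sphi a)); exists g.
have g_additive : zmod_morphism g.
  move=> a b; apply: i_inj; rewrite rmorphB !gE.
  by have := phi_lin 1 a b (rmorph1 s); rewrite !mul1r.
have phi0 : phi 0 = 0 by rewrite /phi mulr0 iterD0 oppr0.
have phiM r a : phi (i r * a) = i r * phi a.
  have sr : s (i r) = i r by apply/i_image; exists r.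
  by have := phi_lin (i r) a 0 sr; rewrite phi0 !subr0.
(* Wilson's theorem [(p-1)! = -1] accounts for the sign in [phi]. *)
have phi1 : phi 1 = 1.
  apply/eqP; rewrite /phi mulr1 D_ffact eqr_oppLR -addr_eq0 -mulrSr.
  by rewrite -(dvdn_pcharf charA) -Wilson.
exists (HB.pack_for {additive A -> R} g
  (GRing.isZmodMorphism.Build A R g g_additive)).
split=> [r a|r] /=; apply: i_inj; rewrite ?rmorphM !gE //.
by rewrite -[X in phi X]mulr1 phiM phi1 mulr1.
Qed.
End Splitting.

(** * Artin-Schreier polynomials in characteristic [p] *)

Section FrobeniusRoots.
Variables (R : idomainType) (p : nat).
Hypothesis charR : p \in [pchar R].

Lemma uniq_natr_mul (c : R) : c != 0 -> uniq [seq j%:R * c | j <- iota 0 p].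
Proof.
move=> c_neq0; rewrite map_inj_in_uniq ?iota_uniq // => j m.
rewrite !mem_iota !add0n => /andP[_ jp] /andP[_ mp] /(mulIf c_neq0) /eqP.
wlog le_jm : j m jp mp / (j <= m)%N.
  move=> IH; case/orP: (leq_total j m) => le; last rewrite eq_sym => /IH->;
    by auto.
rewrite eq_sym -subr_eq0 -natrB // -(dvdn_pcharf charR) => pdvd.
have /eqP : (m - j)%N == 0%N.
  apply: contraTT pdvd; rewrite -lt0n => /gtnNdvd -> //.
  exact: leq_ltn_trans (leq_subr _ _) mp.
by move/eqP; rewrite subn_eq0 => le_mj; apply/eqP; rewrite eqn_leq le_jm.
Qed.

Lemma exprDp (a b : R) : (a + b) ^+ p = a ^+ p + b ^+ p.
Proof. by rewrite -!(pFrobenius_autE charR) rmorphD. Qed.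

Lemma exprnatp n : (n%:R : R) ^+ p = n%:R.
Proof. by rewrite -(pFrobenius_autE charR) rmorph_nat. Qed.

(** For nonzero [c] this is the product of the ['X - j c] over [j] in [F_p]. *)
Definition artin_schreier (c : R) : {poly R} := 'X^p - (c ^+ p.-1) *: 'X.

Lemma horner_artin_schreier c a :
  (artin_schreier c).[a] = a ^+ p - c ^+ p.-1 * a.
Proof. by rewrite !hornerE. Qed.

Lemma artin_schreier_root c j : root (artin_schreier c) (j%:R * c).
Proof.
rewrite /root horner_artin_schreier exprMn exprnatp mulrCA -exprSr.
rewrite prednK ?subrr //; exact/prime_gt0/(pcharf_prime charR).
Qed.

Lemma size_artin_schreier c : size (artin_schreier c) = p.+1.
Proof.
rewrite size_polyDl ?size_polyXn // size_polyN.
rewrite (leq_ltn_trans (size_scale_leq _ _)) // size_polyX ltnS.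
exact/prime_gt1/(pcharf_prime charR).
Qed.

Lemma artin_schreier_monic c : artin_schreier c \is monic.
Proof.
rewrite monicE lead_coefDl ?lead_coefXn // size_polyN size_polyXn.
rewrite (leq_ltn_trans (size_scale_leq _ _)) // size_polyX ltnS.
exact/prime_gt1/(pcharf_prime charR).
Qed.

(** The remainder of [q] has degree below [p] but [p] distinct roots [j c], so it is zero. The
    divisor is monic, so division works over a domain. *)
Lemma artin_schreier_dvd c q : c != 0 ->
  (forall j, q.[j%:R * c] = 0) -> exists d, q = d * artin_schreier c.
Proof.
move=> c_neq0 q0; set P := artin_schreier c.
have mP : P \is monic by exact: artin_schreier_monic.
have qE := Pdiv.IdomainMonic.divp_eq mP q; exists (q %/ P).
suff r0 : q %% P = 0 by rewrite {1}qE r0 addr0.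
apply/eqP/negPn/negP => r_neq0.
have /(max_poly_roots r_neq0)/(_ (uniq_natr_mul c_neq0)) :
    all (root (q %% P)) [seq j%:R * c | j <- iota 0 p].
  apply/allP => _ /mapP[j _ ->]; have := q0 j.
  rewrite {1}qE hornerD hornerM (rootP (artin_schreier_root c j)) mulr0 add0r.
  by move/rootP.
rewrite size_map size_iota ltnNge -ltnS -(size_artin_schreier c) ltn_modp.
by rewrite monic_neq0.
Qed.

(** The [p] images of integers already exhaust the roots of ['X^p - 'X]; one more would exceed its
    degree. *)
Lemma expr_char_id (a : R) : a ^+ p = a -> exists2 j, (j < p)%N & a = j%:R.
Proof.
move=> ap; pose s : seq R := [seq j%:R * 1 | j <- iota 0 p].
have : a \in s.
  apply/negPn/negP => as_; have P0 : artin_schreier 1 != 0.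
    exact/monic_neq0/artin_schreier_monic.
  have := max_poly_roots (rs := a :: s) P0; rewrite size_artin_schreier /=.
  rewrite size_map size_iota ltnn as_ uniq_natr_mul ?oner_neq0 //.
  suff -> : root (artin_schreier 1) a && all (root (artin_schreier 1)) s.
    by move=> /(_ isT isT).
  rewrite /root horner_artin_schreier expr1n mul1r ap subrr eqxx /=.
  by apply/allP => _ /mapP[j _ ->]; apply: artin_schreier_root.
by case/mapP=> j; rewrite mem_iota add0n mulr1 => /andP[_ jp] ->; exists j.
Qed.

End FrobeniusRoots.

(** * Extensionality of morphisms, and restriction to invariant rings *)

Lemma mpoly_rmorph_ext n (k : nzRingType) (T : nzRingType)
    (g h : {rmorphism {mpoly k[n]} -> T}) :
  (forall c, g c%:MP = h c%:MP) -> (forall i, g 'X_i = h 'X_i) -> g =1 h.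
Proof.
move=> ghC ghX q; rewrite (mpolyE q) !rmorph_sum; apply: eq_bigr => m _ /=.
rewrite -mul_mpolyC !rmorphM /= ghC mpolyXE_id !rmorph_prod; congr (_ * _).
by apply: eq_bigr => i _; rewrite !rmorphXn /= ghX.
Qed.

Lemma generated_invariant (k : fieldType) (S : comAlgType k)
    (gens : seq {lrmorphism S -> S}) s :
  (forall g : {lrmorphism S -> S}, List.In g gens -> g s = s) ->
  s \in Defs.invariant (generated gens).
Proof.
move=> gens_s; apply/invariantP => g.
elim=> {g} [g /gens_s||g h _ gs _ hs|g h _ gs gh _] //=; first by rewrite hs gs.
by rewrite -{1}gs gh.
Qed.

Section Restriction.
Variables (k : fieldType) (S : comAlgType k) (H : {lrmorphism S -> S} -> Prop).
Variable s : {lrmorphism S -> S}.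
Hypothesis sH : forall a, a \in Defs.invariant H -> s a \in Defs.invariant H.

Definition invring_map (a : invring H) : invring H := InvRing (sH (valP a)).

Fact invring_map_zmod : zmod_morphism invring_map.
Proof. by move=> a b; apply: val_inj; apply: raddfB. Qed.

Fact invring_map_monoid : monoid_morphism invring_map.
Proof.
by split=> [|a b]; apply: val_inj; [apply: rmorph1 | apply: rmorphM].
Qed.

HB.instance Definition _ :=
  GRing.isZmodMorphism.Build (invring H) (invring H) invring_map
    invring_map_zmod.
HB.instance Definition _ :=
  GRing.isMonoidMorphism.Build (invring H) (invring H) invring_map
    invring_map_monoid.

Lemma val_iter_invring_map n a : val (iter n invring_map a) = iter n s (val a).
Proof. by elim: n => //= n ->. Qed.

End Restriction.

(** * Shifts of [y] and forms additive in [(x2, y)] *)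

Section Shifts.
Variables (k : fieldType) (p : nat).
Hypothesis charp : p \in [pchar k].
Notation S := {mpoly k[4]}.
Notation x1 := (x1 k).
Notation x2 := (x2 k).
Notation x3 := (x3 k).
Notation y := (y k).

(** Stated for ring morphisms so as to apply to evaluation composed with [shift_poly], which carries
    no linear structure here. *)
Lemma mpoly4_rmorph_ext (T : nzRingType) (g h : {rmorphism S -> T}) :
  (forall c, g c%:MP = h c%:MP) ->
  g x1 = h x1 -> g x2 = h x2 -> g x3 = h x3 -> g y = h y -> g =1 h.
Proof.
move=> ghC gh1 gh2 gh3 gh4; apply: mpoly_rmorph_ext => // i.
case: i => [[|[|[|[|//]]]] lti];
  [move: gh1 | move: gh2 | move: gh3 | move: gh4];
  by rewrite /x1 /x2 /x3 /y (bool_irrelevance isT lti).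
Qed.

Lemma lrmorphC (g : {lrmorphism S -> S}) c : g c%:MP = c%:MP.
Proof. by rewrite -alg_mpolyC linearZ rmorph1. Qed.

Lemma mpoly4_lrmorph_ext (g h : {lrmorphism S -> S}) :
  g x1 = h x1 -> g x2 = h x2 -> g x3 = h x3 -> g y = h y -> g =1 h.
Proof.
by apply: mpoly4_rmorph_ext => c;
  exact: etrans (lrmorphC g c) (esym (lrmorphC h c)).
Qed.

(** Common family of [sigma] ([t = x3]) and [tau3] ([t = beta *: x1]). *)
Definition shift (t : S) : {lrmorphism S -> S} := subst x1 x2 x3 (y + t).

Lemma shiftE t :
  [/\ shift t x1 = x1, shift t x2 = x2, shift t x3 = x3 & shift t y = y + t].
Proof. exact: substE. Qed.

Lemma shift0 : shift 0 =1 id.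
Proof.
by have [e1 e2 e3 e4] := shiftE 0; apply: mpoly4_ext; rewrite // e4 addr0.
Qed.

Lemma iter_shift t n : shift t t = t -> iter n (shift t) =1 shift (n%:R * t).
Proof.
move=> tt; elim: n => [|n IHn] a; first by rewrite mul0r shift0.
have [e1 e2 e3 e4] := shiftE t; have [f1 f2 f3 f4] := shiftE (n%:R * t).
have [g1 g2 g3 g4] := shiftE (n.+1%:R * t); rewrite iterS IHn.
apply: (mpoly4_lrmorph_ext (g := shift t \o shift (n%:R * t))) => /=.
- by rewrite f1 e1 g1.
- by rewrite f2 e2 g2.
- by rewrite f3 e3 g3.
rewrite f4 g4 rmorphD rmorphM rmorph_nat /= e4 tt.
by rewrite mulrSr mulrDl mul1r [_ * t + t]addrC addrA.
Qed.

(** The generic shift [a(y + T)], with [T] the variable of [{poly S}]. *)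
Definition shift_poly : {rmorphism S -> {poly S}} :=
  mmap (polyC \o @mpolyC 4 k)
    (fun i => nth 0 [:: x1%:P; x2%:P; x3%:P; y%:P + 'X] i).

Lemma horner_shift_poly t a : (shift_poly a).[t] = shift t a.
Proof.
have [e1 e2 e3 e4] := shiftE t.
apply: (mpoly4_rmorph_ext (g := horner_eval t \o shift_poly)) => [c|||| ] /=;
  rewrite /horner_eval ?mmapX ?mmap1U /=.
- by rewrite mmapC /= hornerC; apply/esym/lrmorphC.
- by rewrite hornerC.
- by rewrite hornerC.
- by rewrite hornerC.
- by rewrite hornerD hornerC hornerX.
Qed.

(** Iterates of [shift c] fix [a], so [a(y + T) - a] vanishes at every [T = j c] and is divisible by
    [artin_schreier c]; then put [T = t]. *)
Lemma shift_dvd c t a : c != 0 -> shift c c = c -> shift c a = a ->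
  exists d, shift t a - a = (t ^+ p - c ^+ p.-1 * t) * d.
Proof.
move=> c_neq0 cc ca.
have charS : p \in [pchar S] by apply: (rmorph_pchar (mpolyC 4 (R := k))).
have [j|d dE] := artin_schreier_dvd (q := shift_poly a - a%:P) charS c_neq0.
  rewrite hornerD hornerN hornerC horner_shift_poly -iter_shift //.
  by rewrite iter_fix // subrr.
exists d.[t]; rewrite -horner_artin_schreier mulrC -hornerM -dE.
by rewrite hornerD hornerN hornerC horner_shift_poly.
Qed.

Section AdditiveForm.
Variables u v w : k.

(** Here [s] and [t] stand for [x2] and [y]. By additivity, a generator changes the form at
    [(x2, y)] by its value at the displacement. *)
Definition additive_form (s t : S) : S :=
  t ^+ p + u *: s ^+ p + (v *: s - w *: t) * x1 ^+ p.-1.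

Lemma additive_formD s t s' t' :
  additive_form (s + s') (t + t') = additive_form s t + additive_form s' t'.
Proof.
have charS : p \in [pchar S] by apply: (rmorph_pchar (mpolyC 4 (R := k))).
rewrite /additive_form !(exprDp charS) !scalerDr -!mul_mpolyC; ring.
Qed.

Lemma additive_form_x1 a b :
  additive_form (a *: x1) (b *: x1) =
  (b ^+ p + u * a ^+ p + v * a - w * b) *: x1 ^+ p.
Proof.
have p_gt0 := prime_gt0 (pcharf_prime charp).
rewrite /additive_form !exprZn !scalerA -scalerBl -scalerAl -exprS prednK //.
by rewrite -!scalerDl addrA.
Qed.

Lemma lrmorph_additive_form (g : {lrmorphism S -> S}) s t :
  g x1 = x1 -> g (additive_form s t) = additive_form (g s) (g t).
Proof.
move=> g1; rewrite /additive_form !rmorphD rmorphM rmorphB /=.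
by rewrite !linearZ_LR /= !rmorphXn /= g1.
Qed.

End AdditiveForm.

End Shifts.

(** * The explicit invariants, and verification of the criterion *)

Theorem proposition5p11 (k : fieldType) (p : nat) (hp : p \in [pchar k])
    (alpha beta : k) (halpha : alpha \notin prime_subfield p)
    (hbeta : ~ in_prime_adjoin p alpha beta) :
  let R := invring (G alpha beta) in
  let A := invring (G' alpha beta) in
  let i : {rmorphism R -> A} := invincl (@G'_sub_G k alpha beta) in
  direct_summand i.
Proof.
move=> R A i; have p_pr := pcharf_prime hp; have p_gt0 := prime_gt0 p_pr.
(* Every subfield contains [0 = 1 - 1]. *)
have beta_neq0 : beta != 0.
  apply: contra_notN hbeta => /eqP -> K [K1 KB _] _ _.
  by rewrite -(subrr 1) KB.
have alphap : alpha ^+ p - alpha != 0.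
  rewrite subr_eq0; apply: contraNN halpha => /eqP /(expr_char_id hp)[j jp ->].
  by apply/existsP; exists (Ordinal jp).
(* [u], [v], [w] solve the equations making the form vanish at the displacements of [tau1], [tau2],
   [tau3]: [1 + u + v = w], [1 + u alpha^p + v alpha = w] and [beta^p = w beta]. Solving for [u]
   divides by [alpha^p - alpha]. *)
pose w := beta ^+ p.-1.
pose u := (w - 1) * (1 - alpha) / (alpha ^+ p - alpha).
pose v := w - 1 - u.
pose L := additive_form p u v w.
have L1 : L (x1 k) (x1 k) = 0.
  have := additive_form_x1 hp u v w 1 1.
  rewrite /L !scale1r !expr1n => ->.
  rewrite [X in X *: _](_ : _ = 0) ?scale0r //.
  by rewrite /v; ring.
have L2 : L (alpha *: x1 k) (x1 k) = 0.
  have := additive_form_x1 hp u v w alpha 1.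
  rewrite /L !scale1r !expr1n => ->.
  rewrite [X in X *: _](_ : _ = 0) ?scale0r //.
  by rewrite /v /u; field.
have L3 : L 0 (beta *: x1 k) = 0.
  have := additive_form_x1 hp u v w 0 beta.
  rewrite /L scale0r => ->.
  rewrite [X in X *: _](_ : _ = 0) ?scale0r //.
  by rewrite expr0n (gtn_eqF p_gt0) /w -exprSr prednK // !mulr0 !addr0 subrr.
pose t : {mpoly k[4]} := x3 k ^+ p - (beta *: x1 k) ^+ p.-1 * x3 k.
(* The displacement of [sigma] yields [t], the [theta] above, because [w = beta^(p-1)]. *)
have L4 : L 0 (x3 k) = t.
  rewrite /L /additive_form /t expr0n (gtn_eqF p_gt0) !scaler0 addr0.
  by rewrite sub0r exprZn -!scalerAl mulNr -scalerAl mulrC.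
have t_neq0 : t != 0.
  (* Specialising [x3] to [1] and the other variables to [0] sends [t] to [1], as [p - 1 > 0]. *)
  have [e1 _ e3 _] := substE (0 : {mpoly k[4]}) 0 1 0.
  apply/eqP => /(congr1 (subst 0 0 1 0)).
  rewrite /t rmorphB rmorphM !rmorphXn /=.
  rewrite linearZ /= e1 e3 scaler0 expr1n expr0n -(subnKC (prime_gt1 p_pr)) /=.
  by rewrite mul0r subr0 raddf0 => /eqP; rewrite oner_eq0.
have Lg (g : {lrmorphism {mpoly k[4]} -> {mpoly k[4]}}) :
    g (x1 k) = x1 k -> g (L (x2 k) (y k)) = L (g (x2 k)) (g (y k)).
  exact: lrmorph_additive_form.
have tg (g : {lrmorphism {mpoly k[4]} -> {mpoly k[4]}}) :
    g (x1 k) = x1 k -> g (x3 k) = x3 k -> g t = t.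
  by move=> g1 g3; rewrite /t rmorphB rmorphM !rmorphXn /= linearZ /= g1 g3.
have [a1 a2 a3 a4] : [/\ tau1 k (x1 k) = x1 k, tau1 k (x2 k) = x2 k + x1 k,
  tau1 k (x3 k) = x3 k & tau1 k (y k) = y k + x1 k] by exact: substE.
have [b1 b2 b3 b4] : [/\ tau2 alpha (x1 k) = x1 k,
  tau2 alpha (x2 k) = x2 k + alpha *: x1 k,
  tau2 alpha (x3 k) = x3 k & tau2 alpha (y k) = y k + x1 k] by exact: substE.
have [c1 c2 c3 c4] : [/\ tau3 beta (x1 k) = x1 k, tau3 beta (x2 k) = x2 k,
  tau3 beta (x3 k) = x3 k & tau3 beta (y k) = y k + beta *: x1 k].
  exact: substE.
have [s1 s2 s3 s4] : [/\ sigma k (x1 k) = x1 k, sigma k (x2 k) = x2 k,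
  sigma k (x3 k) = x3 k & sigma k (y k) = y k + x3 k] by exact: substE.
have inG'P a : reflect [/\ tau1 k a = a, tau2 alpha a = a & tau3 beta a = a]
    (a \in Defs.invariant (G' alpha beta)).
  apply: (iffP idP) => [/invariantP aG'|[ta1 ta2 ta3]].
    by split; apply: aG'; apply: generated_gen => /=; tauto.
  by apply: generated_invariant => g /= [<-|[<-|[<-|[]]]].
(* Such a [g] and [sigma] move variables only by multiples of [x1] or [x3], which both fix, so they
   commute. *)
have sC (g : {lrmorphism {mpoly k[4]} -> {mpoly k[4]}}) u1 u2 :
    g (x1 k) = x1 k -> g (x2 k) = x2 k + u1 *: x1 k -> g (x3 k) = x3 k ->
    g (y k) = y k + u2 *: x1 k -> forall a, g (sigma k a) = sigma k (g a).
  move=> g1 g2 g3 g4.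
  apply: (mpoly4_lrmorph_ext (g := g \o sigma k) (h := sigma k \o g)) => /=.
  - by rewrite s1 g1.
  - by rewrite g2 s2 g2 raddfD /= linearZ /= s1 s2.
  - by rewrite s3 g3.
  - by rewrite g4 s4 !raddfD /= linearZ /= g4 g3 s1 s4 addrAC.
have sG' a : a \in Defs.invariant (G' alpha beta) ->
    sigma k a \in Defs.invariant (G' alpha beta).
  case/inG'P=> ta1 ta2 ta3; apply/inG'P; split.
  - by rewrite (sC _ 1 1) ?scale1r // ta1.
  - by rewrite (sC _ alpha 1) ?scale1r // ta2.
  - by rewrite (sC _ 0 beta) ?scale0r ?addr0 // ta3.
have tG' : t \in Defs.invariant (G' alpha beta).
  by apply/inG'P; split; apply: tg.
have fG' : L (x2 k) (y k) \in Defs.invariant (G' alpha beta).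
  apply/inG'P; split; rewrite Lg //.
  - by rewrite a2 a4 /L (additive_formD hp) -/L L1 addr0.
  - by rewrite b2 b4 /L (additive_formD hp) -/L L2 addr0.
  - by rewrite c2 c4 -[X in L X _]addr0 /L (additive_formD hp) -/L L3 addr0.
have pcharA : p \in [pchar A].
  rewrite inE p_pr; apply/eqP/val_inj; rewrite rmorph_nat /=.
  exact/pcharf0/(rmorph_pchar (mpolyC 4 (R := k))).
apply: (@direct_summand_invariants R A i (invring_map sG') p
  (InvRing tG') (InvRing fG')).
- exact: pcharA.
- by move=> r1 r2 /(congr1 val) /= ?; apply: val_inj.
(* An element of [A] fixed by [sigma] is fixed by all generators of [G], hence lies in [R]. *)
- move=> a; split=> [/(congr1 val) /= sa|[r <-]]; last first.
    apply: val_inj => /=; have /invariantP := valP r; apply.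
    by apply: generated_gen => /=; tauto.
  have aG : val a \in Defs.invariant (G alpha beta).
    have [ta1 ta2 ta3] := inG'P _ (valP a).
    by apply: generated_invariant => g /= [<-|[<-|[<-|[<-|[]]]]].
  by exists (InvRing aG); apply: val_inj.
- by move=> a b /(congr1 val) /= /(mulfI t_neq0) ?; apply: val_inj.
- by apply: val_inj; apply: tg.
- apply: val_inj; rewrite /= Lg // s2 s4 -[X in L X _]addr0 /L.
  by rewrite (additive_formD hp) -/L L4.
(* [sigma^p] shifts [y] by [p x3 = 0]. *)
- move=> a; apply: val_inj; rewrite val_iter_invring_map.
  rewrite -/(shift (x3 k)) iter_shift //.
  rewrite (pcharf0 (rmorph_pchar (mpolyC 4 (R := k)) hp)) mul0r; exact: shift0.
- move=> a; have [ta1 ta2 ta3] := inG'P _ (valP a).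
  have bx_neq0 : beta *: x1 k != 0.
    by rewrite -mul_mpolyC mulf_neq0 ?mpolyC_eq0 // -msupp_eq0 msuppX.
  have [|d dE] := shift_dvd hp (x3 k) bx_neq0 _ ta3.
    by rewrite linearZ; congr (_ *: _); exact: c1.
  (* The quotient [d] is so far only in [S]. Applying [g] to [sigma a - a = t d] gives
     [t * g d = t * d], and [t] cancels. *)
  have gd (g : {lrmorphism {mpoly k[4]} -> {mpoly k[4]}}) : g t = t ->
      g (val a) = val a -> g (sigma k (val a)) = sigma k (g (val a)) -> g d = d.
    move=> gt ga gs; apply: (mulfI t_neq0); rewrite -{1}gt -rmorphM -dE.
    by rewrite rmorphB /= gs ga.
  have dG' : d \in Defs.invariant (G' alpha beta).
    apply/inG'P; split; apply: gd => //; try exact: tg.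
    - by rewrite (sC _ 1 1) ?scale1r.
    - by rewrite (sC _ alpha 1) ?scale1r.
    - by rewrite (sC _ 0 beta) ?scale0r ?addr0.
  by exists (InvRing dG'); apply: val_inj.
Qed.
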